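(* Let $X$ and $Y$ be regular isodyne topological spaces with $|X| = |Y| = \omega_1$. Then the product space $X \times Y$ is $\omega$-resolvable.
   Context: A topological space $X$ is isodyne if every nonempty open subset of $X$ has cardinality $|X|$. For a cardinal $\kappa$, a space $X$ is $\kappa$-resolvable if there is an indexed family $(D_i)_{i<\kappa}$ of dense subsets of $X$ with $D_i \cap D_j = \emptyset$ for $i \neq j$; $\omega$-resolvable is the case $\kappa=\omega$. Products carry the product topology. *)

(* Defs.v *)
From mathcomp Require Import all_boot all_order.
From mathcomp Require Import boolp classical_sets functions cardinality.
From mathcomp Require Import wochoice filter topology.

Set Implicit Arguments.
Unset Strict Implicit.
Unset Printing Implicit Defensive.

Local Open Scope classical_set_scope.
Local Open Scope card_scope.

(* [le] is a well-order of type [omega_1], the first uncountable ordinal. *)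
Definition order_type_omega1 (W : Type) (le : rel W) : Prop :=
  [/\ well_order le,
      ~ countable [set: W] &
      forall w : W, countable [set v : W | le v w /\ v <> w]].

(* |A| = omega_1; any two well-orders of type omega_1 are isomorphic, so the
   choice of the representative [W] of the ordinal does not matter. *)
Definition card_omega1 (T : Type) (A : set T) : Prop :=
  exists (W : Type) (le : rel W), order_type_omega1 le /\ A #= [set: W].

Definition isodyne (X : topologicalType) : Prop :=
  forall U : set X, open U -> U !=set0 -> U #= [set: X].

(* The index type [K] stands for the cardinal |K|. *)
Definition resolvable (K : Type) (X : topologicalType) : Prop :=
  exists D : K -> set X,
    (forall i, dense (D i)) /\
    (forall i j, i <> j -> D i `&` D j = set0).

Definition omega_resolvable (X : topologicalType) : Prop := resolvable nat X.

(* Main.v *)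
Require Import Defs.
From HB Require Import structures.
From mathcomp Require Import all_boot all_order.
From mathcomp Require Import boolp classical_sets functions cardinality.
From mathcomp Require Import filter topology.

(** The product carries a colouring by natural numbers that depends only on
    points of omega_1: X and Y inject into a well-order W of type omega_1, and
    a colouring osc_color of the pairs of W is pulled back.  It has the property
    (osc_interval, a case of Moore's theorem on oscillations of traces of walks)
    that on any rectangle with two uncountable sides it takes every value of
    arbitrarily long intervals of integers.  A nonempty open subset of X * Y
    contains a rectangle whose sides are neighbourhoods, and these are
    uncountable because the spaces are isodyne.  An interval of length 2 ^ i.+1
    contains an m such that m.+1 has 2-adic valuation i, so the classes of the
    colouring by that valuation are pairwise disjoint dense sets.

    The colouring compares, for a and b in W, two functions on a finite set.
    The functions are rho^~ a and rho^~ b, from a family that is finite-to-one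
    (rho_finite_to_one) and coherent: any two members differ at finitely many
    points of their common domain (rho_coherent).  The finite set is the lower
    trace of the walk from b down to a along ladders cofinal in each ordinal.
    osc_color a b counts how often, along the trace, the sign of the comparison
    passes from rho x a <= rho x b to rho x b < rho x a.

    Traces concatenate (trace_cat): from b to a point x just below a limit del,
    the walk first does what the walk from b to del does, and what happens after
    del adds only points close to del.  Fix unbounded sets A and B and a limit
    del which reflects the relevant first-order facts about them, as the trace
    of a countable elementary submodel would.  Then a pair a, b above del can be
    replaced by a pair that looks the same on the trace from b to del but for
    which this trace is prolonged.  Two variants exist: on the new points the
    two functions can be made equal by coherence (extend), or the first can be
    made larger by finite-to-oneness (extend_gt).  Doing one and then the other
    adds exactly one oscillation (osc_step).  Iteration gives points of B with
    any number of consecutive oscillation counts, all with respect to the same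
    point of A above del; that point is finally reflected below del, which adds
    the same amount to every count. *)

Local Open Scope classical_set_scope.

Set Implicit Arguments.
Unset Strict Implicit.
Import Order.TTheory.
Local Open Scope order_scope.

Lemma countable_setU (T : Type) (A B : set T) :
  countable A -> countable B -> countable (A `|` B).
Proof.
move=> cA cB; rewrite -bigcup2E; apply: bigcup_countable => // -[|[|i]] _ //=.
Qed.

(** * Well-orders of type omega_1 *)

Section Omega1.
Context {d : Order.disp_t} {W : orderType d}.
Hypothesis wf_lt : well_founded (fun x y : W => x < y).
Hypothesis countable_init : forall w : W, countable [set v : W | v < w].
Hypothesis uncountable_W : ~ countable [set: W].
(* A default value; all limits considered below lie above it. *)
Variable x0 : W.

Implicit Types (a b c x y : W) (s : seq W).

Lemma least_element (P : set W) :
  P !=set0 -> exists2 m, P m & forall x, P x -> m <= x.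
Proof.
case=> y; elim/(well_founded_ind wf_lt): y => y IH Py.
have [[z [Pz ltzy]]|none] := pselect (exists z, P z /\ z < y).
  exact: IH ltzy Pz.
exists y => // x Px; rewrite leNgt; apply/negP => ltxy.
by apply: none; exists x.
Qed.

(** The points of a countable set without strict upper bound would cover W by
    countably many countable initial segments. *)
Lemma countable_bounded (S : set W) :
  countable S -> exists b, forall x, S x -> x < b.
Proof.
move=> cS; apply: contrapT => /forallNP noB; apply: uncountable_W.
apply: (@sub_countable _ _ _ (\bigcup_(x in S) ([set v | v < x] `|` [set x]))).
  apply: subset_card_le => y _.
  have /existsNP[x /not_implyP[Sx /negP]] := noB y.
  rewrite -leNgt le_eqVlt => /orP[/eqP->|ltyx]; exists x => //.
  - by right.
  - by left.
by apply: bigcup_countable => // x _; exact: countable_setU.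
Qed.

Definition idx b : W -> nat :=
  sval (cid (elimT (countable_injP _) (countable_init b))).

Lemma idx_inj b x y : x < b -> y < b -> idx b x = idx b y -> x = y.
Proof.
rewrite /idx; case: cid => f /= finj ltx lty; apply: finj; exact: mem_set.
Qed.

Lemma finite_idx_le b n : finite_set [set x | x < b /\ (idx b x <= n)%N].
Proof.
set A := [set x | _].
have injA : {in A &, injective (idx b)}.
  by move=> x y /set_mem[? _] /set_mem[? _]; apply: idx_inj.
rewrite -(eq_finite_set (inj_card_eq injA)).
apply: (sub_finite_set _ (finite_II n.+1)) => _ [x [_ xn] <-].
by rewrite /= ltnS.
Qed.

(** * Ladders and walks *)

(** The records of the enumeration idx b: this is a cofinal subset of b of order
    type at most omega, for successors as well as for limits, so no case
    distinction is ever needed. *)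
Definition ladder b : set W :=
  [set c | c < b /\ forall x, x < b -> (idx b x < idx b c)%N -> x < c].

(** The point of [a, b) that idx b enumerates first is a record. *)
Lemma ladder_cofinal a b : a < b -> exists2 c, ladder b c & a <= c.
Proof.
move=> ltab.
have [|n /asboolP[c [ltcb leac <-] cmin]] :=
  @ex_minnP (fun n => `[< exists c, [/\ c < b, a <= c & idx b c = n] >]).
  by exists (idx b a); apply/asboolP; exists a.
exists c => //; split=> // x ltxb; apply: contraTT; rewrite -!leNgt -leqNgt.
move=> lecx; apply: cmin; apply/asboolP; exists x; split=> //.
exact: le_trans lecx.
Qed.

Lemma ladder_idx_lt a b c :
  ladder b c -> a < b -> c < a -> (idx b c < idx b a)%N.
Proof.
move=> [ltcb cmax] ltab ltca; case: ltngtP => // [/(cmax _ ltab)|].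
  by move/(lt_trans ltca); rewrite ltxx.
by move/(idx_inj ltcb ltab) => eqca; rewrite eqca ltxx in ltca.
Qed.

Lemma ladder_finite a b : a < b -> finite_set [set c | ladder b c /\ c < a].
Proof.
move=> ltab; apply: (sub_finite_set _ (finite_idx_le b (idx b a))).
by move=> c [cc ltca]; split; [case: cc | apply/ltnW/ladder_idx_lt].
Qed.

Definition step x b : W :=
  xget b [set c | [/\ ladder b c, x <= c &
                      forall c', ladder b c' -> x <= c' -> c <= c']].

Lemma stepP x b : x < b ->
  [/\ ladder b (step x b), x <= step x b &
      forall c, ladder b c -> x <= c -> step x b <= c].
Proof.
move=> ltxb; rewrite /step; case: xgetP => [c _ //|none].
have [c cc lexc] := ladder_cofinal ltxb.
have [|m [cm lexm] mmin] := @least_element [set c | ladder b c /\ x <= c].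
  by exists c.
by case: (none m); split=> // c' *; apply: mmin.
Qed.

Lemma step_lt x b : x < b -> step x b < b.
Proof. by case/stepP => -[]. Qed.

Lemma step_ge x b : x < b -> x <= step x b.
Proof. by case/stepP. Qed.

Lemma step_unique x b c : x < b -> ladder b c -> x <= c ->
  (forall c', ladder b c' -> x <= c' -> c <= c') -> step x b = c.
Proof.
move=> /stepP[cs les smin] cc lexc cmin.
by apply: le_anti; rewrite smin // cmin.
Qed.

(** The upper trace of the walk from b down to x, without its end point x. *)
Definition walk x : W -> seq W :=
  Fix wf_lt (fun=> seq W) (fun b rec =>
    match pselect (x < b) with
    | left ltxb => b :: rec (step x b) (step_lt ltxb)
    | right _ => [::]
    end).

Lemma walkE x b : walk x b = if x < b then b :: walk x (step x b) else [::].
Proof.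
rewrite {1}/walk Fix_eq; last first.
  by move=> y f g fg; case: pselect => // lt; rewrite fg.
by case: pselect => [->|/negP/negbTE->].
Qed.

Lemma walk_lt x b c : c \in walk x b -> x < c.
Proof.
elim/(well_founded_ind wf_lt): b => b IH; rewrite walkE.
case: ifP => // ltxb; rewrite inE => /orP[/eqP->//|].
exact/IH/step_lt.
Qed.

(** * A coherent family of finite-to-one functions *)

(** A variant of the maximal weight of the walk: the weight of a step is the
    index of the rung reached instead of the number of rungs below x.  Both are
    constant between two consecutive rungs, which is what coherence needs; the
    injectivity of idx b gives finiteness. *)
Definition rho x b : nat := (\max_(c <- walk x b) idx c (step x c))%N.

Lemma rho_step x b :
  x < b -> rho x b = maxn (idx b (step x b)) (rho x (step x b)).
Proof. by move=> ltxb; rewrite /rho [walk x b]walkE ltxb big_cons. Qed.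

(** The first step from b can only reach one of the finitely many c with
    idx b c <= n, and the rest of the walk is governed by induction at c. *)
Lemma rho_finite_to_one b n : finite_set [set x | x < b /\ (rho x b <= n)%N].
Proof.
elim/(well_founded_ind wf_lt): b => b IH.
apply: (@sub_finite_set _ _ (\bigcup_(c in [set c | c < b /\ (idx b c <= n)%N])
  ([set c] `|` [set x | x < c /\ (rho x c <= n)%N]))).
  move=> x [ltxb]; rewrite rho_step // geq_max => /andP[le1 le2].
  exists (step x b); first by split => //; exact: step_lt.
  have := step_ge ltxb; rewrite le_eqVlt => /orP[/eqP|ltxs]; first by left.
  by right.
apply: bigcup_finite => [|c [ltcb _]]; first exact: finite_idx_le.
by rewrite finite_setU; split; [exact: finite_set1 | exact: IH].
Qed.

(** Below a, the first step from b reaches one of finitely many rungs c: those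
    below a and the first one from a on.  For each c, rho x b is the maximum of a
    constant and rho x c, hence equals rho x c up to finitely many x; and rho x c
    agrees with rho x a for almost all x, by induction at a or at c. *)
Lemma rho_coherent a b :
  a <= b -> finite_set [set x | x < a /\ rho x a <> rho x b].
Proof.
elim/(well_founded_ind wf_lt): b a => b IH a.
rewrite le_eqVlt => /orP[/eqP->|ltab].
  by apply: (sub_finite_set _ (finite_set0 W)) => x [].
apply: (@sub_finite_set _ _
  (\bigcup_(c in [set c | ladder b c /\ c < a] `|` [set step a b])
    ([set c] `|` [set x | x < c /\ (rho x c <= idx b c)%N] `|`
     [set x | [/\ x < a, x < c & rho x a <> rho x c]]))).
  move=> x [ltxa neq]; have ltxb := lt_trans ltxa ltab.
  have [cs les smin] := stepP ltxb.
  exists (step x b).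
    have [ltsa|leas] := ltP (step x b) a; [by left | right].
    have [ca lea amin] := stepP ltab.
    apply: step_unique => //; first exact: le_trans (ltW ltxa) lea.
    move=> c cc lexc; apply: amin => //.
    exact: le_trans leas (smin _ cc lexc).
  move: les; rewrite le_eqVlt => /orP[/eqP|ltxs]; first by left; left.
  have [le|gt] := leqP (rho x (step x b)) (idx b (step x b)).
    by left; right.
  right; split=> // eqs; apply: neq.
  by rewrite (rho_step ltxb) eqs; symmetry; apply/maxn_idPr/ltnW.
apply: bigcup_finite.
  by rewrite finite_setU; split; [exact: ladder_finite | exact: finite_set1].
move=> c cc; rewrite 2!finite_setU; split; [split|].
- exact: finite_set1.
- exact: rho_finite_to_one.
case: cc => [[_ ltca]|->].
  apply: (sub_finite_set _ (IH _ ltab _ (ltW ltca))) => x [_ ltxc neq].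
  by split=> // /esym.
apply: (sub_finite_set _ (IH _ (step_lt ltab) _ (step_ge ltab))).
by move=> x [ltxa _ neq].
Qed.

Definition limit b := forall x, x < b -> exists2 y, x < y & y < b.

Lemma finite_bounded_lim b (S : set W) : x0 < b -> limit b -> finite_set S ->
  (forall x, S x -> x < b) -> exists2 c, c < b & forall x, S x -> x < c.
Proof.
move=> lt0b limb /finite_seqP[s ->] {S} /= ltsb.
elim: s ltsb => [|y s IH] ltsb; first by exists x0.
have /IH[c ltcb ltsc] : forall x, [set` s] x -> x < b.
  by move=> x xs; apply: ltsb; rewrite inE; apply/orP; right.
have [|z lt1 lt2] := limb (Order.max y c).
  by rewrite gt_max ltcb ltsb // mem_head.
exists z => // x; move: lt1; rewrite gt_max => /andP[ltyz ltcz].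
by rewrite inE => /orP[/eqP->//|/ltsc ltxc]; exact: lt_trans ltcz.
Qed.

Lemma rho_eventually_eq del a b :
  x0 < del -> limit del -> del <= a -> del <= b ->
  exists2 g, g < del & forall x, g <= x -> x < del -> rho x a = rho x b.
Proof.
move=> lt0 limd lea leb.
have [||g ltg gP] := @finite_bounded_lim del
  ([set x | x < del /\ rho x del <> rho x a] `|`
   [set x | x < del /\ rho x del <> rho x b]) lt0 limd.
- by rewrite finite_setU; split; exact: rho_coherent.
- by move=> x [[]|[]].
exists g => // x legx ltxd; apply: contrapT => neq.
have : x < g.
  apply: gP; have [eqa|nea] := pselect (rho x del = rho x a); last by left.
  by right; split => // eqb; apply: neq; rewrite -eqa eqb.
by rewrite ltNge legx.
Qed.

(** * Lower traces *)

(** Without a rung below x the value is x0, which is harmless: traces are only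
    computed at points above x0. *)
Definition last_rung x b : W :=
  xget x0 [set c | [/\ ladder b c, c < x &
                       forall c', ladder b c' -> c' < x -> c' <= c]].

Lemma last_rung_lt x b : x0 < x -> last_rung x b < x.
Proof. by rewrite /last_rung; case: xgetP => // c _ []. Qed.

Lemma last_rung_cases x b :
  last_rung x b = x0 \/ (ladder b (last_rung x b) /\ last_rung x b < x).
Proof. by rewrite /last_rung; case: xgetP => [c _ []|]; [right|left]. Qed.

(** The enumeration is increasing on the ladder, so the largest rung below x is
    the one of largest index, and indices are bounded by that of x. *)
Lemma last_rung_max x b c : x < b -> ladder b c -> c < x -> c <= last_rung x b.
Proof.
move=> ltxb cc ltcx; rewrite /last_rung; case: xgetP => [m _ [_ _]|none].
  exact.
have [||n /asboolP[m [cm ltmx <-] mmax]] :=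
  @ex_maxnP (fun n => `[< exists c, [/\ ladder b c, c < x & idx b c = n] >])
    (idx b x).
- by exists (idx b c); apply/asboolP; exists c.
- by move=> n /asboolP[m [cm ltmx <-]]; apply/ltnW/ladder_idx_lt.
case: (none m); split=> // c' cc' ltcx'; rewrite leNgt; apply/negP => ltmc.
have := mmax (idx b c'); rewrite leqNgt ladder_idx_lt //; last by case: cc'.
by move=> /(_ _)/negP; apply => //; apply/asboolP; exists c'.
Qed.

Definition prepend x b s := last_rung x b :: [seq y <- s | last_rung x b < y].

(** The lower trace of Todorcevic: the increasing list of the strict records of
    last_rung x along the walk from b to x. *)
Definition trace x b : seq W := foldr (prepend x) [::] (walk x b).

Lemma trace_lt x b : x0 < x -> all (fun y => y < x) (trace x b).
Proof.
move=> lt0; rewrite /trace; elim: (walk x b) => //= c s IH.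
rewrite last_rung_lt //=; apply/allP => y; rewrite mem_filter => /andP[_].
exact: (allP IH).
Qed.

(** While the rungs below del stay below x, a step towards x cannot stop in
    [x, del), so it is the step towards del. *)
Lemma walk_cat x del b : x < del -> del <= b ->
  (forall b', b' \in walk del b -> forall c, ladder b' c -> c < del -> c < x) ->
  walk x b = walk del b ++ walk x del.
Proof.
move=> ltxd; elim/(well_founded_ind wf_lt): b => b IH.
rewrite le_eqVlt => /orP[/eqP<-|ltdb] cx.
  by rewrite [walk del del]walkE ltxx.
rewrite [walk x b]walkE [walk del b]walkE ltdb (lt_trans ltxd ltdb) /=.
congr cons.
have [cs les smin] := stepP ltdb.
have -> : step x b = step del b.
  apply: step_unique => //; first exact: lt_trans ltdb.
    exact/ltW/(lt_le_trans ltxd).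
  move=> c cc lexc; apply: smin => //; rewrite leNgt; apply/negP.
  move=> /(cx b _ c cc); rewrite walkE ltdb mem_head => /(_ isT).
  by rewrite ltNge lexc.
apply: IH; [exact: step_lt | exact: les | move=> b' b'walk; apply: cx].
by rewrite walkE ltdb inE b'walk orbT.
Qed.

(** The bound g separates the two parts: the rungs met before del lie below g,
    so they are the same for x and for del, and they do not filter out any point
    of the trace from del to x. *)
Lemma trace_cat g x del b : x0 < g -> g <= x -> x < del -> del <= b ->
  (forall b', b' \in walk del b -> forall c, ladder b' c -> c < del -> c < g) ->
  all (fun y => g <= y) (trace x del) ->
  trace x b = trace del b ++ trace x del.
Proof.
move=> lt0 legx ltxd ledb cg geL; rewrite /trace (@walk_cat x del) //; last first.
  by move=> b' /cg H c cc ltcd; exact: lt_le_trans (H c cc ltcd) legx.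
rewrite foldr_cat -/(trace x del).
elim: (walk del b) cg => //= b' t IH cg.
rewrite IH; last by move=> b'' b''t; apply: cg; rewrite inE b''t orbT.
have eqlast : last_rung x b' = last_rung del b'.
  rewrite /last_rung; congr xget; apply/seteqP; split=> c /= [cc ltc cmax].
    split=> //; first exact: lt_trans ltxd.
    move=> c' cc' ltc'; apply: cmax => //.
    by apply: lt_le_trans legx; apply: (cg b') => //; exact: mem_head.
  split=> //.
    by apply: lt_le_trans legx; apply: (cg b') => //; exact: mem_head.
  by move=> c' cc' ltc'; apply: cmax => //; exact: lt_trans ltxd.
have ltlast : last_rung del b' < g.
  case: (last_rung_cases del b') => [->//|[cc ltc]].
  by apply: (cg b') => //; exact: mem_head.
rewrite /prepend eqlast; congr cons; rewrite filter_cat; congr cat.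
apply/all_filterP/allP => y /(allP geL); exact: lt_le_trans.
Qed.

Lemma trace_ge x b c :
  x < b -> ladder b c -> c < x -> all (fun y => c <= y) (trace x b).
Proof.
move=> ltxb cc ltcx; rewrite /trace walkE ltxb /=.
have lec := last_rung_max ltxb cc ltcx.
rewrite lec; apply/allP => y; rewrite mem_filter => /andP[lty _].
exact/ltW/(le_lt_trans lec).
Qed.

Lemma trace_nonempty x b : x < b -> trace x b <> [::].
Proof. by move=> ltxb; rewrite /trace walkE ltxb. Qed.

Lemma ladder_bounded_lim del b : x0 < del -> limit del -> del <= b ->
  exists2 g, g < del & forall b', b' \in walk del b ->
    forall c, ladder b' c -> c < del -> c < g.
Proof.
move=> lt0 limd ledb.
have [||g ltg gP] := @finite_bounded_lim del
  (\bigcup_(b' in [set` walk del b]) [set c | ladder b' c /\ c < del]) lt0 limd.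
- apply: bigcup_finite => [|b' /walk_lt ltb']; first exact: finite_seq.
  exact: ladder_finite.
- by move=> c [b' _ []].
by exists g => // b' b'walk c cc ltc; apply: gP; exists b'.
Qed.

(** * Reflecting ordinals *)

Lemma countable_seq_below b : countable [set s | all (fun x => x < b) s].
Proof.
apply/countable_injP; exists (fun s => choice.pickle (map (idx b) s)).
move=> s t /set_mem/= sb /set_mem/= tb /(pcan_inj choice.pickleK).
elim: s t sb tb => [|x s IH] [|y t] //= /andP[ltx sb] /andP[lty tb] [exy est].
by rewrite (idx_inj ltx lty exy) (IH t).
Qed.

(** A Loewenheim-Skolem closure: del is the supremum of a sequence, each term of
    which bounds chosen witnesses for the parameters below the previous one.  A
    finite list of parameters below del is already below some term. *)
Lemma reflection (I : countType) (Q : I -> seq W -> set W) :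
  exists del, [/\ x0 < del, limit del &
    forall i s, all (fun x => x < del) s -> Q i s !=set0 ->
      exists2 x, x < del & Q i s x].
Proof.
have /choice[nxt nxtP] : forall b, exists b', b < b' /\
    forall i s, all (fun x => x < b) s -> xget x0 (Q i s) < b'.
  move=> b; have [|b' b'P] := @countable_bounded ([set b] `|`
    (fun p => xget x0 (Q p.1 p.2)) @`
      ([set: I] `*` [set s | all (fun x => x < b) s])).
    apply: countable_setU; first exact: countable1.
    apply: card_le_trans (card_image_le _ _) _.
    by apply: countableX => //; exact: countable_seq_below.
  exists b'; split; first by apply: b'P; left.
  by move=> i s sb; apply: b'P; right; exists (i, s).
pose D n := iter n nxt x0.
have ltD n : D n < D n.+1 by have [] := nxtP (D n).
have leD m n : (m <= n)%N -> D m <= D n.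
  elim: n => [|n IH]; first by rewrite leqn0 => /eqP->.
  rewrite leq_eqVlt => /orP[/eqP->//|]; rewrite ltnS => /IH/le_trans; apply.
  exact: ltW.
have [|b bP] := @countable_bounded (range D).
  by apply: card_le_trans (card_image_le _ _) _.
have [|del delub delmin] := @least_element [set b | forall n, D n <= b].
  by exists b => n; apply/ltW/bP; exists n.
have ltDd n : D n < del by exact: lt_le_trans (ltD n) (delub _).
have below x : x < del -> exists n, x < D n.
  move=> ltx; apply: contrapT => /forallNP H.
  have : del <= x by apply: delmin => n; rewrite leNgt; apply/negP/H.
  by rewrite leNgt ltx.
exists del; split; first exact: (ltDd 0%N).
  by move=> x /below[n ltx]; exists (D n).
move=> i s sd ex; exists (xget x0 (Q i s)); last exact: xgetPex.
suff [n sn] : exists n, all (fun x => x < D n) s.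
  by apply: lt_trans (ltDd n.+1); have [_] := nxtP (D n); exact.
elim: s sd {ex} => [|x s IH] /=; first by exists 0%N.
move=> /andP[/below[m ltx] /IH[n sn]]; exists (maxn m n).
rewrite (lt_le_trans ltx) ?leD ?leq_maxl //=.
by apply: sub_all sn => y lty; rewrite (lt_le_trans lty) ?leD ?leq_maxr.
Qed.

Definition unbounded (A : set W) := forall x, exists2 a, A a & x <= a.

Definition large_above (Z : set W) (eta : W) :=
  forall F, all (fun x => eta <= x) F -> forall (n : nat) x,
  exists a, [/\ Z a, x <= a & all (fun y => n < rho y a)%N F].

(** Otherwise, for some n there are, above each ordinal, finite sets on which all
    far members of Z take a value at most n somewhere.  Take a limit del below
    which such sets are cofinal and a member a of Z above del: rho^~ a takes
    values at most n cofinally below del, which contradicts finite-to-oneness. *)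
Lemma large_above_exists (Z : set W) :
  unbounded Z -> exists eta, large_above Z eta.
Proof.
move=> ubZ.
have /choice[h hP] : forall n : nat, exists eta, forall F,
    all (fun x => eta <= x) F ->
    forall x, exists a, [/\ Z a, x <= a & all (fun y => n < rho y a)%N F].
  move=> n; apply: contrapT => /forallNP noeta.
  (* s is the list [:: y] of the ordinal above which a set F is sought, and mu
     bounds both F and the ordinal x from which on F is bad. *)
  pose Q (_ : unit) s : set W := [set mu | exists F, exists x,
    [/\ all (fun y => head x0 s <= y) F, all (fun y => y < mu) F, x <= mu &
        forall a, Z a -> x <= a -> ~~ all (fun y => n < rho y a)%N F]].
  have [del [lt0 limd refl]] := reflection Q.
  have [a Za lea] := ubZ del.
  have [||g ltg gP] := @finite_bounded_lim del
    [set x | x < del /\ (rho x a <= n)%N] lt0 limd.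
  - apply: (sub_finite_set _ (rho_finite_to_one a n)) => x [ltxd len].
    by split=> //; exact: lt_le_trans lea.
  - by move=> x [].
  have [||mu ltmu [F [x [geF ltF lex bad]]]] := refl tt [:: g].
  - by rewrite /= ltg.
  - have /existsNP[F /not_implyP[geF /existsNP[x /forallNP bad]]] := noeta g.
    have [|mu muP] := @countable_bounded [set` x :: F].
      exact/finite_set_countable/finite_seq.
    exists mu, F, x; split => //.
    + by apply/allP => y yF; apply: muP; rewrite /= inE yF orbT.
    + by apply/ltW/muP; rewrite /= mem_head.
    by move=> b Zb lexb; apply/negP => H; exact: (bad b).
  have /allPn[y yF] := bad a Za (le_trans lex (le_trans (ltW ltmu) lea)).
  rewrite -leqNgt => len.
  have : y < g by apply: gP; split => //; exact: lt_trans (allP ltF _ yF) ltmu.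
  by rewrite ltNge (allP geF).
have [eta etaP] : exists eta, forall x, range h x -> x < eta.
  by apply: countable_bounded; apply: card_le_trans (card_image_le _ _) _.
exists eta => F geF n x; apply: (hP n).
apply: sub_all geF => y; apply: le_trans; apply/ltW/etaP; by exists n.
Qed.

Definition agreeing (A : set W) s (va : seq nat) : set W :=
  [set a | A a /\ map (rho^~ a) s = va].

(** What the extension argument remembers of a pair a, b above del: the trace s
    to del, the values va and vb on it, a bound g for the rungs met on the way
    and for the disagreement of rho^~ a and rho^~ b below del, and a rung c of
    del beyond g, which keeps the trace from del to points above c beyond g. *)
Definition same_type (A B : set W) (g c : W) s (va vb : seq nat) : set W :=
  [set del | ladder del c /\ exists a b,
    [/\ agreeing A s va a /\ agreeing B s vb b, del <= a /\ del <= b,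
        trace del b = s,
        forall b', b' \in walk del b ->
          forall c, ladder b' c -> c < del -> c < g &
        forall x, g <= x -> x < del -> rho x a = rho x b]].

(** The consequences of del being the trace on omega_1 of an elementary submodel
    that contains A, B and rho. *)
Definition elementary (A B : set W) del := [/\ x0 < del, limit del,
  forall g c s va vb, g < del -> c < del -> all (fun x => x < del) s ->
    same_type A B g c s va vb del ->
    exists2 del', del < del' & same_type A B g c s va vb del',
  forall s va, all (fun x => x < del) s ->
    (exists2 a, agreeing A s va a & del <= a) ->
    exists2 eta, eta < del & large_above (agreeing A s va) eta &
  forall g s va, g < del -> all (fun x => x < del) s ->
    (exists2 a, agreeing A s va a & g <= a) ->
    exists a, [/\ agreeing A s va a, g <= a & a < del]].

Lemma no_max x : exists y, x < y.
Proof.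
have [|y yP] := @countable_bounded [set x]; first exact: countable1.
by exists y; apply: yP.
Qed.

Lemma elementary_exists (A B : set W) : exists del, elementary A B del.
Proof.
pose Q (i : (seq nat * seq nat) + seq nat + seq nat) (s : seq W) : set W :=
  (* Each clause describes ordinals of which reflection yields one below del:
     strict bounds of the places where a type occurs; bounds for large_above, or
     for the set itself when it is bounded; members of A beyond g. *)
  match i with
  | inl (inl v) => [set eta | forall x, same_type A B (nth x0 s 0) (nth x0 s 1)
                     (drop 2 s) v.1 v.2 x -> x < eta]
  | inl (inr va) => [set eta | large_above (agreeing A s va) eta \/
                     forall x, agreeing A s va x -> x < eta]
  | inr va => [set a | agreeing A (behead s) va a /\ head x0 s <= a]
  end.
have [del [lt0 limd refl]] := reflection Q.
exists del; split => // [g c s va vb ltg ltc lts Sd|s va lts [a Aa lea]|].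
- apply: contrapT => none.
  have [||eta lteta etaP] := refl (inl (inl (va, vb))) [:: g, c & s].
  + by rewrite /= ltg ltc.
  + have [eta lteta] := no_max del; exists eta => x /=; rewrite drop0 => Sx.
    apply: le_lt_trans lteta; rewrite leNgt; apply/negP => ltx.
    by apply: none; exists x.
  have := etaP del; rewrite /= drop0 => /(_ Sd).
  by move/(lt_trans lteta); rewrite ltxx.
- have [|eta lteta [farA|bd]] := refl (inl (inr va)) s lts.
  + have [[x bx]|ub] :=
      pselect (exists x, forall y, agreeing A s va y -> y < x).
      by exists x; right.
    have [|eta etaP] := @large_above_exists (agreeing A s va); last first.
      by exists eta; left.
    move=> x; apply: contrapT => none; apply: ub; exists x => y Ay.
    by rewrite ltNge; apply/negP => lexy; apply: none; exists y.
  + by exists eta.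
  + by have := lt_trans (le_lt_trans lea (bd _ Aa)) lteta; rewrite ltxx.
move=> g s va ltg lts [a Aa lea].
have [||x ltx [Ax lex]] := refl (inr va) (g :: s).
- by rewrite /= ltg.
- by exists a.
- by exists x.
Qed.

(** * Prolonging traces *)

Section Extension.
Variables (A B : set W) (del : W).
Hypothesis goodD : elementary A B del.

Lemma x0_lt_del : x0 < del. Proof. by case: goodD. Qed.

(** The type of the pair a, b at del also occurs at some del' > del, by
    reflection.  A pair a', b' realizing it there has a trace from b' to del made
    of the old one followed by the trace from del' to del, which lies in
    [g, del) where rho^~ a' and rho^~ b' agree. *)
Lemma extend eta a b : eta < del -> A a -> B b -> del <= a -> del <= b ->
  exists a' b' t, [/\ A a' /\ B b', del <= a' /\ del <= b',
    trace del b' = trace del b ++ t,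
    {in trace del b, forall x, rho x a' = rho x a /\ rho x b' = rho x b} &
    [/\ t <> [::], {in t, forall x, eta <= x /\ x < del} &
        {in t, forall x, rho x a' = rho x b'}]].
Proof.
move=> lteta Aa Bb lea leb; have [lt0 limd simD _ _] := goodD.
have [g1 ltg1 g1P] := ladder_bounded_lim lt0 limd leb.
have [g2 ltg2 g2P] := rho_eventually_eq lt0 limd lea leb.
have [|g] := limd (Order.max (Order.max x0 eta) (Order.max g1 g2)).
  by rewrite !gt_max lt0 lteta ltg1.
rewrite !gt_max => /andP[/andP[lt0g ltetag] /andP[ltg1g ltg2g]] ltg.
have [c cc legc] := ladder_cofinal ltg.
have ltc : c < del by case: cc.
set s := trace del b.
have [||del' ltdel' [cc' [a' [b'
    [[[Aa' va] [Bb' vb]] [lea' leb'] eqL cg ee]]]]] :=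
  simD g c s (map (rho^~ a) s) (map (rho^~ b) s) ltg ltc.
- exact: trace_lt.
- split=> //; exists a, b; split=> //.
    by move=> b' /g1P H c' cc' ltc'; exact: lt_trans (H _ cc' ltc') ltg1g.
  by move=> x lex; apply: g2P; exact: le_trans (ltW ltg2g) lex.
have geL : all (fun y => g <= y) (trace del del').
  apply: sub_all (trace_ge ltdel' cc' ltc) => y; exact: le_trans.
have tP x : x \in trace del del' -> g <= x /\ x < del.
  by move=> xt; split; [exact: (allP geL) | exact: (allP (trace_lt del' lt0))].
exists a', b', (trace del del'); split=> //.
- by split; apply/ltW; [exact: lt_le_trans lea' | exact: lt_le_trans leb'].
- rewrite (trace_cat lt0g (ltW ltg) ltdel' leb') ?eqL //.
- move=> x xL; split.
    by move/eq_in_map: va; apply.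
  by move/eq_in_map: vb; apply.
split=> [|x /tP[lex ltx]|x /tP[lex ltx]].
- exact: trace_nonempty.
- by split=> //; exact: le_trans (ltW ltetag) lex.
- by apply: ee => //; exact: lt_trans ltdel'.
Qed.

(** Prolonging the trace first, beyond the bound of large_above, fixes b' and the
    new points; only then is a' chosen, to dominate rho^~ b' on these points. *)
Lemma extend_gt a b : A a -> B b -> del <= a -> del <= b ->
  exists a' b' t, [/\ A a' /\ B b', del <= a' /\ del <= b',
    trace del b' = trace del b ++ t,
    {in trace del b, forall x, rho x a' = rho x a /\ rho x b' = rho x b} &
    t <> [::] /\ {in t, forall x, (rho x b' < rho x a')%N}].
Proof.
move=> Aa Bb lea leb; have [lt0 _ _ farA _] := goodD.
have [||eta lteta farE] := farA (trace del b) (map (rho^~ a) (trace del b)).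
- exact: trace_lt.
- by exists a.
have [a1 [b' [t [[_ Bb'] [_ leb'] eqL agree [tN tP _]]]]] :=
  extend lteta Aa Bb lea leb.
have [|a' [[Aa' va] lea' gt]] := farE t _ (\max_(x <- t) rho x b')%N del.
  by apply/allP => x /tP[].
exists a', b', t; split=> //.
  move=> x xL; split; last by case: (agree x xL).
  by move/eq_in_map: va; apply.
split=> // x xt; apply: leq_ltn_trans (allP gt x xt).
exact: leq_bigmax_seq.
Qed.

End Extension.

(** * Oscillations *)

Definition rise (p q : bool) : bool := ~~ p && q.

(** The virtual initial letter is true, so that a leading true is no rise. *)
Definition osc (w : seq bool) : nat := count id (pairmap rise true w).

Definition word a b s : seq bool := [seq (rho x b < rho x a)%N | x <- s].

Definition osc_color a b : nat := osc (word a b (trace a b)).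

Lemma word_cat a b s t : word a b (s ++ t) = word a b s ++ word a b t.
Proof. exact: map_cat. Qed.

Lemma eq_word a b a' b' s :
  {in s, forall x, rho x a' = rho x a /\ rho x b' = rho x b} ->
  word a' b' s = word a b s.
Proof. by move=> H; apply/eq_in_map => x /H[-> ->]. Qed.

Lemma word_const v a b s : {in s, forall x, (rho x b < rho x a)%N = v} ->
  word a b s = nseq (size s) v.
Proof.
by rewrite /word => /eq_in_map->; elim: s => //= _ s ->.
Qed.

Lemma osc_cat w u : osc (w ++ u) =
  (osc w + count id (pairmap rise (last true w) u))%N.
Proof. by rewrite /osc pairmap_cat count_cat. Qed.

Lemma osc_block w m n :
  osc (w ++ nseq m.+1 false ++ nseq n.+1 true) = (osc w).+1.
Proof.
have blk v k : count id (pairmap rise v (nseq k v)) = 0%N.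
  by elim: k => //= k ->; rewrite /rise andNb.
have lst (v p : bool) k : last p (nseq k.+1 v) = v.
  by elim: k p => //= k IH p; apply: IH.
by rewrite catA 2!osc_cat last_cat lst /= !blk /rise andbF !addn0 addn1.
Qed.

Section Oscillation.
Variables (A B : set W) (del : W).
Hypothesis goodD : elementary A B del.

(** One block of equalities followed by one block of strict inequalities. *)
Lemma osc_step a b : A a -> B b -> del <= a -> del <= b ->
  exists a' b', [/\ A a' /\ B b', del <= a' /\ del <= b',
    {subset trace del b <= trace del b'},
    {in trace del b, forall x, rho x a' = rho x a} &
    osc (word a' b' (trace del b')) = (osc (word a b (trace del b))).+1 /\
    last false (word a' b' (trace del b'))].
Proof.
move=> Aa Bb lea leb.
have [a1 [b1 [t1 [[Aa1 Bb1] [lea1 leb1] eqL1 agree1 [t1N _ eq1]]]]] :=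
  extend goodD (x0_lt_del goodD) Aa Bb lea leb.
have [a2 [b2 [t2 [[Aa2 Bb2] [lea2 leb2] eqL2 agree2 [t2N gt2]]]]] :=
  extend_gt goodD Aa1 Bb1 lea1 leb1.
have sub1 : {subset trace del b <= trace del b1}.
  by move=> x xL; rewrite eqL1 mem_cat xL.
exists a2, b2; split=> //.
- by move=> x /sub1 xL; rewrite eqL2 mem_cat xL.
- move=> x xL; have [-> _] := agree2 x (sub1 x xL).
  by have [] := agree1 x xL.
have -> : word a2 b2 (trace del b2) = word a b (trace del b) ++
    nseq (size t1).-1.+1 false ++ nseq (size t2).-1.+1 true.
  rewrite eqL2 word_cat (eq_word agree2) eqL1 word_cat (eq_word agree1) -catA.
  rewrite (@word_const false _ _ t1); last by move=> x /eq1 ->; rewrite ltnn.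
  rewrite (@word_const true _ _ t2) //.
  by case: (t1) t1N => // ? ? _; case: (t2) t2N.
split; first exact: osc_block.
by rewrite catA last_cat; elim: (size t2).-1.
Qed.

(** Later steps change the first coordinate but not its values on earlier traces,
    so the last one serves for all the pairs of the chain. *)
Lemma osc_chain n a b : A a -> B b -> del <= a -> del <= b ->
  exists a' (bs : nat -> W), [/\ A a', del <= a',
    {in trace del b, forall x, rho x a' = rho x a} &
    forall k, (k < n)%N ->
    [/\ B (bs k), del <= bs k,
      osc (word a' (bs k) (trace del (bs k))) =
        (osc (word a b (trace del b)) + k.+1)%N &
      last false (word a' (bs k) (trace del (bs k)))]].
Proof.
elim: n a b => [|n IH] a b Aa Bb lea leb.
  by exists a, (fun=> b); split.
have [a1 [b1 [[Aa1 Bb1] [lea1 leb1] sub1 agree1 [osc1 last1]]]] :=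
  osc_step Aa Bb lea leb.
have [a' [bs [Aa' lea' agree' bsP]]] := IH a1 b1 Aa1 Bb1 lea1 leb1.
exists a', (fun k => if k is k'.+1 then bs k' else b1); split=> //.
  by move=> x xL; rewrite agree' ?agree1 //; exact: sub1.
move=> [_|k]; last first.
  by rewrite ltnS => /bsP[? ? -> ?]; split=> //; rewrite osc1 addSnnS.
have -> : word a' b1 (trace del b1) = word a1 b1 (trace del b1).
  by apply: eq_word => x /agree'.
by split=> //; rewrite osc1 addn1.
Qed.

End Oscillation.

(** A chain above del is turned into pairs with a common first coordinate a' just
    below del.  The trace from bs k to a' is the trace from bs k to del followed
    by the trace from del to a'; on the latter part all rho^~ (bs k) agree with
    rho^~ del.  Since the words of the chain end in true, this part contributes
    the same number of rises for every k. *)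
Theorem osc_interval (A B : set W) (n : nat) : unbounded A -> unbounded B ->
  exists m, forall k, (k < n)%N ->
    exists a b, [/\ A a, B b & osc_color a b = (m + k)%N].
Proof.
move=> ubA ubB; have [del gd] := elementary_exists A B.
have [lt0 limd _ _ reflA] := gd.
have [a0 Aa0 lea0] := ubA del; have [b0 Bb0 leb0] := ubB del.
have [a [bs [Aa lea _ bsP]]] := osc_chain gd n Aa0 Bb0 lea0 leb0.
have /choice[g gP] : forall k, exists g, (k < n)%N -> [/\ g < del,
    forall b', b' \in walk del (bs k) ->
      forall c, ladder b' c -> c < del -> c < g &
    forall x, g <= x -> x < del -> rho x (bs k) = rho x del].
  move=> k; case: (ltnP k n) => [/bsP[_ lebk _ _]|]; last by exists x0.
  have [g1 ltg1 g1P] := ladder_bounded_lim lt0 limd lebk.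
  have [g2 ltg2 g2P] := rho_eventually_eq lt0 limd lebk (lexx del).
  exists (Order.max g1 g2) => _; split; first by rewrite gt_max ltg1.
    by move=> b' b't c cc ltc; rewrite lt_max (g1P b').
  by move=> x; rewrite ge_max => /andP[_]; exact: g2P.
have [||g0 ltg0 g0P] :=
  @finite_bounded_lim del (g @` [set k | (k < n)%N]) lt0 limd.
- exact/finite_image/finite_II.
- by move=> _ [k /gP[? _ _] <-].
have [|g1] := limd (Order.max x0 g0); first by rewrite gt_max lt0.
rewrite gt_max => /andP[lt0g1 ltg01] ltg1.
have [c cc legc] := ladder_cofinal ltg1; have ltc : c < del by case: cc.
have [g2 ltcg2 ltg2] := limd c ltc.
pose S := flatten [seq trace del (bs k) | k <- iota 0 n].
have [||a' [[Aa' va] lea' lta']] := reflA g2 S (map (rho^~ a) S) ltg2.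
- apply/allP => x /flattenP[s /mapP[k _ ->]].
  exact: (allP (trace_lt (bs k) lt0)).
- by exists a => //; exact: le_trans (ltW ltg2) lea.
have ltca' : c < a' := lt_le_trans ltcg2 lea'.
have geL : all (fun y => g1 <= y) (trace a' del).
  by apply: sub_all (trace_ge lta' cc ltca') => y; exact: le_trans.
exists (osc (word a0 b0 (trace del b0)) + 1 +
  count id (pairmap rise true (word a' del (trace a' del))))%N.
move=> k ltkn; have [Bk lek osck lastk] := bsP k ltkn.
have [ltgk cgk ek] := gP k ltkn.
have ltgk1 : g k < g1 by apply: lt_trans ltg01; apply: g0P; exists k.
exists a', (bs k); split=> //; rewrite /osc_color.
rewrite (@trace_cat g1 a' del) //; first last.
- by move=> b' b't c' cc' ltc'; exact: lt_trans (cgk b' b't c' cc' ltc') ltgk1.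
- by apply: le_trans lea'; exact/ltW/(le_lt_trans legc).
rewrite word_cat.
have -> : word a' (bs k) (trace del (bs k)) = word a (bs k) (trace del (bs k)).
  apply: eq_word => x xL; split=> //.
  move/eq_in_map: va; apply; apply/flattenP; exists (trace del (bs k)) => //.
  by apply/mapP; exists k; rewrite // mem_iota.
have -> : word a' (bs k) (trace a' del) = word a' del (trace a' del).
  apply: eq_word => x xL; split=> //; apply: ek.
    exact: le_trans (ltW ltgk1) (allP geL x xL).
  apply: lt_trans lta'; apply: (allP (trace_lt _ _) x xL).
  exact: lt_trans lt0g1 (le_lt_trans legc ltca').
rewrite osc_cat osck.
have -> : last true (word a (bs k) (trace del (bs k))) = true.
  by case: (word _ _ _) lastk.
move: (osc _) (count _ _) => p q.
by rewrite addn1 addnS !addSn addnAC.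
Qed.

(** * Transfer to spaces of cardinality omega_1 *)

(** By recursion, each w goes to a point not yet taken: only countably many are.
    This puts X and Y into one and the same well-order. *)
Lemma injection_into_uncountable (U : choiceType) :
  ~ countable [set: U] -> exists g : W -> U, injective g.
Proof.
move=> uncU; have [u0 _] : [set: U] !=set0.
  by apply/set0P/eqP => eq0; apply: uncU; rewrite eq0.
pose F w (rec : forall v : W, v < w -> U) :=
  xget u0 [set u | forall v (ltvw : v < w), rec v ltvw <> u].
pose g := Fix wf_lt (fun=> U) F.
have gE w : g w = xget u0 [set u | forall v, v < w -> g v <> u].
  rewrite /g Fix_eq // => v r r' rr'; congr (xget u0).
  by apply/seteqP; split=> u Hu z ltz; have := Hu z ltz; rewrite rr'.
have gP v w : v < w -> g v <> g w.
  move=> ltvw; rewrite [g w]gE; case: xgetP => [u _ /(_ v)|none]; first exact.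
  case: uncU; apply: (@sub_countable _ _ _ (g @` [set v | v < w])).
    apply: subset_card_le => u _; apply: contrapT => Hu.
    apply: (none u) => z ltz eq; by apply: Hu; exists z.
  exact: card_le_trans (card_image_le _ _) (countable_init w).
by exists g => v w eqg; case: (ltgtP v w) => // /gP; rewrite eqg.
Qed.

End Omega1.

Section OrderType.
Variables (W : Type) (le : rel W).
Hypothesis omega1_le : order_type_omega1 le.

Let le_min (P : set W) : P !=set0 -> exists2 m, P m & forall x, P x -> le m x.
Proof.
have [wo _ _] := omega1_le => -[x Px].
have [|m [[/asboolP Pm mP] _]] := wo (fun x => `[<P x>]).
  by exists x; apply/asboolP.
by exists m => // y Py; apply: mP; apply/asboolP.
Qed.

Let le_total : total le.
Proof.
move=> x y; have [|m [->|->] mP] := @le_min [set x; y]; first by exists x; left.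
  by rewrite mP //; right.
by rewrite orbC mP //; left.
Qed.

Let le_refl : reflexive le.
Proof. by move=> x; have := le_total x x; rewrite orbb. Qed.

Let le_anti : antisymmetric le.
Proof.
have [wo _ _] := omega1_le => x y /andP[lexy leyx].
have [|m [_ mU]] := wo (fun z => `[<[set x; y] z>]).
  by exists x; apply/asboolP; left.
have <- : m = x.
  by apply: mU; split; [apply/asboolP; left | move=> z /asboolP[->|->]].
by apply: mU; split; [apply/asboolP; right | move=> z /asboolP[->|->]].
Qed.

Let le_trans : transitive le.
Proof.
move=> y x z lexy leyz.
have [|m mxyz mP] := @le_min [set t | [\/ t = x, t = y | t = z]].
  by exists x; constructor.
have [mx my mz] : [/\ le m x, le m y & le m z].
  by split; apply: mP; [constructor 1|constructor 2|constructor 3].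
case: mxyz => eqm; subst m => //.
  by rewrite (le_anti (introT andP (conj lexy mx))).
by rewrite -(le_anti (introT andP (conj leyz my))).
Qed.

Lemma omega1_orderType : exists (d : Order.disp_t) (T : orderType d)
    (g : W -> T), [/\ bijective g, well_founded (fun x y : T => x < y),
    forall w : T, countable [set v | v < w] & ~ countable [set: T]].
Proof.
pose PO := Order.Le_isPOrder.Build (Order.Disp tt tt) {classic W}
  le_refl le_anti le_trans.
pose P : porderType _ := HB.pack {classic W} PO.
pose TO := Order.POrder_isTotal.Build _ P le_total.
pose T : orderType _ := HB.pack {classic W} PO TO.
have ltE (x y : T) : (x < y) = (y != x) && le x y by exact: lt_def.
have [_ unc init] := omega1_le.
exists (Order.Disp tt tt), T, (id : W -> T).
have bijid : bijective (id : W -> T) by exists id.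
have wfT : well_founded (fun x y : T => x < y).
  move=> x; apply: contrapT => nx.
  have [|m nm mP] := @le_min [set y | ~ Acc (fun x y : T => x < y) y].
    by exists x.
  apply: nm; constructor => y; rewrite ltE => /andP[/eqP neq leym].
  apply: contrapT => /mP lemy; apply: neq.
  by apply: le_anti; rewrite lemy leym.
have initT (w : T) : countable [set v | v < w].
  apply: sub_countable (init w); apply: subset_card_le => v.
  by rewrite /= ltE => /andP[/eqP neq]; split=> // /esym.
exact: And4 bijid wfT initT unc.
Qed.

End OrderType.

Lemma card_omega1_injection (X : Type) : card_omega1 [set: X] ->
  exists (d : Order.disp_t) (T : orderType d) (g : X -> T),
    [/\ injective g, well_founded (fun x y : T => x < y),
        forall w : T, countable [set v | v < w],
        ~ countable [set: T] & ~ countable [set: X]].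
Proof.
case=> W [le [omega1_le eqXW]].
have [d [T [g [bijg wfT initT uncT]]]] := omega1_orderType omega1_le.
have [j bijj] := elimT card_bijP eqXW.
exists d, T, (fun x => g (val (j (SigSub (mem_set (I : [set: X] x)))))).
split=> //.
  by move=> x y /(bij_inj bijg)/val_inj/(bij_inj bijj)/(congr1 val).
by rewrite (eq_countable eqXW); case: omega1_le.
Qed.

Lemma uncountable_unbounded (d : Order.disp_t) (T : orderType d) (A : set T) :
  (forall w : T, countable [set v | v < w]) -> ~ countable A -> unbounded A.
Proof.
move=> initT uncA x; apply: contrapT => none; apply: uncA.
apply: sub_countable (initT x); apply: subset_card_le => a Aa /=.
by rewrite ltNge; apply/negP => lexa; apply: none; exists a.
Qed.

(** * Products of isodyne spaces *)

Lemma isodyne_uncountable_image (X : topologicalType) (T : Type) (g : X -> T)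
    (x : X) (U : set X) : isodyne X -> ~ countable [set: X] -> injective g ->
  nbhs x U -> ~ countable (g @` U).
Proof.
move=> isoX uncX injg nU cU; apply: uncX.
have Ux : U° x by exact: nbhs_singleton (nbhs_interior nU).
rewrite -(eq_countable (isoX _ (open_interior U) _)); last by exists x.
apply: (@sub_countable _ _ _ U); first exact: subset_card_le (@interior_subset _ U).
have injU : {in U &, injective g} by move=> y z _ _; exact: injg.
by rewrite -(eq_countable (inj_card_eq injU)).
Qed.

(** The interval contains an element whose successor is 2 ^ i modulo
    2 ^ i.+1. *)
Lemma interval_logn2 (m i : nat) :
  exists2 k, (k < 2 ^ i.+1)%N & logn 2 (m + k).+1 = i.
Proof.
have val t : logn 2 (t * 2 ^ i.+1 + 2 ^ i) = i.
  have -> : (t * 2 ^ i.+1 + 2 ^ i = 2 ^ i * t.*2.+1)%N.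
    by rewrite expnS mulnS -muln2 addnC mulnA [(_ * (t * 2))%N]mulnC.
  rewrite lognM ?expn_gt0 // pfactorK // lognE /= dvdn2 /= odd_double /=.
  by rewrite addn0.
have mE := divn_eq m.+1 (2 ^ i.+1); set t := (_ %/ _)%N in mE.
set r := (_ %% _)%N in mE.
have ltr : (r < 2 ^ i.+1)%N by rewrite ltn_mod expn_gt0.
have lt2 : (2 ^ i < 2 ^ i.+1)%N by rewrite ltn_exp2l.
have [ler|ltir] := leqP r (2 ^ i)%N.
  exists (2 ^ i - r)%N; first exact: leq_ltn_trans (leq_subr _ _) lt2.
  by rewrite -addSn mE -addnA subnKC.
have ler2 : (r <= 2 ^ i.+1 + 2 ^ i)%N := leq_trans (ltnW ltr) (leq_addr _ _).
exists (2 ^ i.+1 + 2 ^ i - r)%N; first by rewrite ltn_subLR // addnC ltn_add2r.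
by rewrite -addSn mE -addnA subnKC // addnA -mulSnr.
Qed.

Unset Implicit Arguments.
Set Strict Implicit.
Local Close Scope order_scope.

Theorem theorem3p7 (X Y : topologicalType)
    (regX : regular_space X) (regY : regular_space Y)
    (isoX : isodyne X) (isoY : isodyne Y)
    (cardX : card_omega1 [set: X]) (cardY : card_omega1 [set: Y]) :
  omega_resolvable (X * Y)%type.
Proof.
have [d [T [g [injg wfT initT uncT uncX]]]] := card_omega1_injection cardX.
have [d' [T' [g' [injg' wfT' initT' _ uncY]]]] := card_omega1_injection cardY.
have [j injj] := injection_into_uncountable wfT' initT' uncT.
have [x0 _] : [set: T] !=set0.
  by apply/set0P/eqP => eq0; apply: uncT; rewrite eq0.
pose color (p : X * Y) := osc_color wfT initT x0 (g p.1) (j (g' p.2)).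
exists (fun i => [set p | logn 2 (color p).+1 = i]); split; last first.
  move=> i k neq; apply/seteqP; split=> // p [/= eqi eqk].
  by apply: neq; rewrite -eqi.
move=> i O [[x y] Oxy] openO.
have [[U V] /= [nU nV] UVO] : nbhs (x, y) O by exact: open_nbhs_nbhs.
have [||m mP] := @osc_interval _ _ wfT initT uncT x0
  (g @` U) ((j \o g') @` V) (2 ^ i.+1).
- apply: uncountable_unbounded => //.
  exact: (isodyne_uncountable_image isoX uncX injg nU).
- apply: uncountable_unbounded => //.
  exact: (isodyne_uncountable_image isoY uncY (inj_comp injj injg') nV).
have [k /mP[_ [_ [[u Uu <-] [v Vv <-] colE]]] logE] := interval_logn2 m i.
exists (u, v); split; first exact: UVO.
by rewrite /= /color /= colE.
Qed.
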